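(* Let $A\in\mathbb{R}^{m\times p}$ (with no zero rows), $B\in\mathbb{R}^{q\times n}$ and $C\in\mathbb{R}^{m\times n}$ be such that the matrix equation $AXB=C$ is consistent. If $0<\alpha<\frac{2}{\|B\|^2}$, then the sequence $\{X^k\}_{k=0}^\infty$ obtained by the greedy randomized block Kaczmarz (GRBK) method (defined in the context) converges in expectation to a solution of $AXB=C$. If $\mathrm{range}(X^0)\subseteq\mathrm{range}(A^T)$ and $\mathrm{range}((X^0)^T)\subseteq\mathrm{range}(B)$, then the GRBK method converges in expectation to the unique minimum norm solution $X_*=A^+CB^+$. Moreover, in this case the solution error satisfies $$\mathbb{E}_k\big[\|X^{k+1}-X_*\|_F^2\big]\le\delta_{k,1/2}\cdot\|X^k-X_*\|_F^2\le\delta\cdot\|X^k-X_*\|_F^2 .$$ Consequently, $$\mathbb{E}\big[\|X^{k+1}-X_*\|_F^2\big]\le\prod_{\ell=0}^k\delta_{\ell,1/2}\cdot\|X^0-X_*\|_F^2\le\delta^{k+1}\cdot\|X^0-X_*\|_F^2 .$$ Here $\delta_{k,1/2}$ is the quantity $\delta_{k,\theta}$ with $\theta=\tfrac12$, and $\delta_{k,\theta}$ and $\delta$ are defined in the context.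
   Context: $M_{i,:}$ denotes the $i$th row of a matrix $M$, $A_{i,:}^T$ the transpose of the $i$th row of $A$, $\|\cdot\|$ the 2-norm (spectral norm for matrices), $\|\cdot\|_F$ the Frobenius norm, $M^+$ the Moore--Penrose pseudoinverse, $\mathrm{range}(M)$ the column space, $\sigma_{\min}(M)$ the smallest singular value, $[m]=\{1,\dots,m\}$. The equation is consistent if it has at least one solution; the minimum norm solution is the solution of smallest Frobenius norm. $\mathbb{E}_k[\cdot]=\mathbb{E}[\,\cdot\mid i_0,\dots,i_{k-1}]$ is the expectation conditional on the first $k$ iterations, $i_j$ being the row index selected at iteration $j$. Convergence in expectation of $X^k$ to $Y$ means $\mathbb{E}[\|X^k-Y\|_F^2]\to0$. GRBK method (initial guess $X^0\in\mathbb{R}^{p\times q}$, parameter $\alpha$): set $R^0=C-AX^0B$. For $k=0,1,2,\dots$: let $$\gamma_k=\tfrac12\Big[\max_{1\le i\le m}\tfrac{\|R^k_{i,:}\|^2}{\|A_{i,:}\|^2}+\tfrac{\|R^k\|_F^2}{\|A\|_F^2}\Big],\qquad \mathcal{J}_k=\{i:\ \|R^k_{i,:}\|^2\ge\gamma_k\|A_{i,:}\|^2\};$$ let $\widetilde R^k$ have rows $\widetilde R^k_{i,:}=R^k_{i,:}$ if $i\in\mathcal{J}_k$ and $\widetilde R^k_{i,:}=0$ otherwise; choose $i_k\in\mathcal{J}_k$ with probability $\|\widetilde R^k_{i_k,:}\|^2/\|\widetilde R^k\|_F^2$; update $$X^{k+1}=X^k+\tfrac{\alpha}{\|A_{i_k,:}\|^2}A_{i_k,:}^T\,(R^k_{i_k,:}B^T),\qquad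 R^{k+1}=R^k-\tfrac{\alpha}{\|A_{i_k,:}\|^2}\,(AA_{i_k,:}^T)\,(R^k_{i_k,:}B^TB),$$ so that $R^k=C-AX^kB$. Standing assumption: at each iteration $k$, the ratios $\|R^k_{i,:}\|^2/\|A_{i,:}\|^2$, $i\in[m]$, are not all equal. Define $$\Omega_k=\Big\{i:\ \tfrac{\|R^k_{i,:}\|^2}{\|A_{i,:}\|^2}<\tfrac1m\sum_{j\in[m]}\tfrac{\|R^k_{j,:}\|^2}{\|A_{j,:}\|^2}\Big\},$$ and let $\varepsilon\in(0,1)$ (depending on $k$) be defined by $\frac1m\sum_{i\in[m]}\frac{\|R^k_{i,:}\|^2}{\|A_{i,:}\|^2}=\varepsilon\cdot\max_{1\le i\le m}\frac{\|R^k_{i,:}\|^2}{\|A_{i,:}\|^2}$. For $\theta\in[0,1]$ let $$\varphi_{k,\theta}=\theta\cdot\frac{1}{\sum_{i\in[m]\setminus\Omega_k}\|A_{i,:}\|^2+\varepsilon\sum_{i\in\Omega_k}\|A_{i,:}\|^2}+(1-\theta)\cdot\frac1{\|A\|_F^2},$$ $$\delta_{k,\theta}=1-(2\alpha-\alpha^2\|B\|^2)\,\varphi_{k,\theta}\,\sigma_{\min}^2(A)\,\sigma_{\min}^2(B),\qquad \delta=1-\frac{2\alpha-\alpha^2\|B\|^2}{\|A\|_F^2}\,\sigma_{\min}^2(A)\,\sigma_{\min}^2(B).$$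
   Formalization: Since δ_{ℓ,1/2} depends on the random residual R^ℓ, the last display is stated with E[∏_{ℓ=0}^k δ_{ℓ,1/2}] in place of ∏_{ℓ=0}^k δ_{ℓ,1/2}; the bound by the random product on every path is false. *)

(* Defs.v *)
From HB Require Import structures.
From mathcomp Require Import all_boot all_order all_algebra.
From mathcomp Require Import all_classical all_reals all_analysis.

Set Implicit Arguments.
Unset Strict Implicit.
Unset Printing Implicit Defensive.

Import Order.TTheory GRing.Theory Num.Theory.
Import numFieldNormedType.Exports.

Local Open Scope classical_set_scope.
Local Open Scope ring_scope.

(* Frobenius norm; on a single row or column it is the Euclidean 2-norm. The
   library norm `|M| on matrices is the max norm, hence the own definition. *)
Definition fnorm (R : realType) (m n : nat) (M : 'M[R]_(m, n)) : R :=
  Num.sqrt (\sum_(i < m) \sum_(j < n) M i j ^+ 2).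

(* Spectral norm, as the operator norm induced by the Euclidean norm. *)
Definition norm2 (R : realType) (m n : nat) (M : 'M[R]_(m, n)) : R :=
  sup [set fnorm (M *m x) | x in [set x : 'cV[R]_n | fnorm x <= 1]].

(* Both singular vectors are required to be unit vectors, so an m x n matrix has
   min(m, n) singular values with multiplicity; in particular 0 is a singular
   value only if rank M < min(m, n). *)
Definition singular_value (R : realType) (m n : nat) (M : 'M[R]_(m, n))
    (s : R) : Prop :=
  0 <= s /\ exists (u : 'cV[R]_m) (v : 'cV[R]_n),
    [/\ fnorm u = 1, fnorm v = 1, M *m v = s *: u & M^T *m u = s *: v].

Definition sigma_min (R : realType) (m n : nat) (M : 'M[R]_(m, n)) : R :=
  inf [set s | singular_value M s].

(* Inclusion of column spaces, range(M) <= range(N); the relation (_ <= _)%MS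
   compares row spaces. *)
Definition range_sub (R : realType) (m n p : nat)
    (M : 'M[R]_(m, n)) (N : 'M[R]_(m, p)) : Prop := (M^T <= N^T)%MS.

Definition is_moore_penrose (R : realType) (m n : nat) (M : 'M[R]_(m, n))
    (P : 'M[R]_(n, m)) : Prop :=
  [/\ M *m P *m M = M, P *m M *m P = P,
      (M *m P)^T = M *m P & (P *m M)^T = P *m M].

(* The Penrose equations have exactly one solution, so the default value 0 is
   never used. The library's pinvmx is only a one-sided inverse on row spaces. *)
Definition mp_inverse (R : realType) (m n : nat) (M : 'M[R]_(m, n)) : 'M[R]_(n, m) :=
  xget 0 [set P | is_moore_penrose M P].

Definition solution (R : realType) (m p q n : nat) (A : 'M[R]_(m, p))
    (B : 'M[R]_(q, n)) (C : 'M[R]_(m, n)) (X : 'M[R]_(p, q)) : Prop :=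
  A *m X *m B = C.

Definition min_norm_solution (R : realType) (m p q n : nat) (A : 'M[R]_(m, p))
    (B : 'M[R]_(q, n)) (C : 'M[R]_(m, n)) (X : 'M[R]_(p, q)) : Prop :=
  solution A B C X /\ forall Y, solution A B C Y -> fnorm X <= fnorm Y.

(* In the next definitions S stands for the current residual R^k. *)

Definition row_ratio (R : realType) (m p n : nat) (A : 'M[R]_(m, p))
    (S : 'M[R]_(m, n)) (i : 'I_m) : R :=
  fnorm (row i S) ^+ 2 / fnorm (row i A) ^+ 2.

Definition max_ratio (R : realType) (m p n : nat) (A : 'M[R]_(m, p))
    (S : 'M[R]_(m, n)) : R :=
  \big[Num.max/0]_(i < m) row_ratio A S i.

Definition mean_ratio (R : realType) (m p n : nat) (A : 'M[R]_(m, p))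
    (S : 'M[R]_(m, n)) : R :=
  m%:R^-1 * \sum_(i < m) row_ratio A S i.

Definition gamma (R : realType) (m p n : nat) (A : 'M[R]_(m, p))
    (S : 'M[R]_(m, n)) : R :=
  2^-1 * (max_ratio A S + fnorm S ^+ 2 / fnorm A ^+ 2).

Definition greedy_set (R : realType) (m p n : nat) (A : 'M[R]_(m, p))
    (S : 'M[R]_(m, n)) : {set 'I_m} :=
  [set i : 'I_m | gamma A S * fnorm (row i A) ^+ 2 <= fnorm (row i S) ^+ 2]%SET.

Definition greedy_residual (R : realType) (m p n : nat) (A : 'M[R]_(m, p))
    (S : 'M[R]_(m, n)) : 'M[R]_(m, n) :=
  \matrix_(i < m, j < n) if i \in greedy_set A S then S i j else 0.

(* It vanishes for i outside greedy_set A S. *)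
Definition select_prob (R : realType) (m p n : nat) (A : 'M[R]_(m, p))
    (S : 'M[R]_(m, n)) (i : 'I_m) : R :=
  fnorm (row i (greedy_residual A S)) ^+ 2 / fnorm (greedy_residual A S) ^+ 2.

Definition grbk_step (R : realType) (m p q n : nat) (A : 'M[R]_(m, p))
    (B : 'M[R]_(q, n)) (alpha : R) (i : 'I_m)
    (XS : 'M[R]_(p, q) * 'M[R]_(m, n)) : 'M[R]_(p, q) * 'M[R]_(m, n) :=
  let c := alpha / fnorm (row i A) ^+ 2 in
  (XS.1 + c *: ((row i A)^T *m (row i XS.2 *m B^T)),
   XS.2 - c *: ((A *m (row i A)^T) *m (row i XS.2 *m B^T *m B))).

(* The pair (X^k, R^k) when the selected indices are s 0, s 1, ...; it only
   depends on s 0, ..., s (k - 1). *)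
Fixpoint grbk (R : realType) (m p q n : nat) (A : 'M[R]_(m, p))
    (B : 'M[R]_(q, n)) (C : 'M[R]_(m, n)) (alpha : R) (X0 : 'M[R]_(p, q))
    (s : nat -> 'I_m) (k : nat) : 'M[R]_(p, q) * 'M[R]_(m, n) :=
  if k is k'.+1 then grbk_step A B alpha (s k') (grbk A B C alpha X0 s k')
  else (X0, C - A *m X0 *m B).

(* The event that the first k selected indices are s 0, ..., s (k - 1). *)
Definition history (T : Type) (m : nat) (I : nat -> T -> 'I_m)
    (s : nat -> 'I_m) (k : nat) : set T :=
  [set w | forall j : nat, (j < k)%N -> I j w = s j].

(* I is the sequence of random row indices of the method: conditionally on
   i_0 = s 0, ..., i_{k-1} = s (k - 1), the index i_k has law select_prob. The
   conditional law is written multiplicatively to cover null histories. *)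
Definition grbk_indices d (T : measurableType d) (R : realType)
    (P : probability T R) (m p q n : nat) (A : 'M[R]_(m, p))
    (B : 'M[R]_(q, n)) (C : 'M[R]_(m, n)) (alpha : R) (X0 : 'M[R]_(p, q))
    (I : nat -> T -> 'I_m) : Prop :=
  (forall k i, measurable (I k @^-1` [set i])) /\
  (forall (s : nat -> 'I_m) (k : nat),
     P (history I s k.+1) =
     (P (history I s k) *
      (select_prob A (grbk A B C alpha X0 s k).2 (s k))%:E)%E).

(* E_k[Z] = E[Z | i_0, ..., i_{k-1}] at the outcome w: the indices take finitely
   many values, so this is the average of Z over the event that the first k
   indices are those observed at w (meaningful if that event is not null,
   which holds for almost every w). *)
Definition cond_expect d (T : measurableType d) (R : realType)
    (P : probability T R) (m : nat) (I : nat -> T -> 'I_m) (k : nat)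
    (Z : T -> R) (w : T) : \bar R :=
  let F := history I (fun j => I j w) k in
  ((fine (P F))^-1%:E * \int[P]_(x in F) (Z x)%:E)%E.

Definition cvg_in_expectation d (T : measurableType d) (R : realType)
    (P : probability T R) (p q : nat) (X : nat -> T -> 'M[R]_(p, q))
    (Y : 'M[R]_(p, q)) : Prop :=
  (fun k => 'E_P[(fun w => fnorm (X k w - Y) ^+ 2)%R]%E) @ \oo --> 0%E.

Definition Omega (R : realType) (m p n : nat) (A : 'M[R]_(m, p))
    (S : 'M[R]_(m, n)) : {set 'I_m} :=
  [set i : 'I_m | row_ratio A S i < mean_ratio A S]%SET.

(* The solution of mean_ratio = eps * max_ratio; max_ratio is positive as soon
   as the ratios are not all equal. *)
Definition eps (R : realType) (m p n : nat) (A : 'M[R]_(m, p))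
    (S : 'M[R]_(m, n)) : R :=
  mean_ratio A S / max_ratio A S.

Definition phi (R : realType) (m p n : nat) (A : 'M[R]_(m, p))
    (S : 'M[R]_(m, n)) (theta : R) : R :=
  theta * (\sum_(i < m | i \notin Omega A S) fnorm (row i A) ^+ 2 +
           eps A S * \sum_(i < m | i \in Omega A S) fnorm (row i A) ^+ 2)^-1 +
  (1 - theta) * (fnorm A ^+ 2)^-1.

Definition delta_theta (R : realType) (m p q n : nat) (A : 'M[R]_(m, p))
    (B : 'M[R]_(q, n)) (alpha : R) (S : 'M[R]_(m, n)) (theta : R) : R :=
  1 - (2 * alpha - alpha ^+ 2 * norm2 B ^+ 2) * phi A S theta *
      sigma_min A ^+ 2 * sigma_min B ^+ 2.

Definition delta (R : realType) (m p q n : nat) (A : 'M[R]_(m, p))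
    (B : 'M[R]_(q, n)) (alpha : R) : R :=
  1 - (2 * alpha - alpha ^+ 2 * norm2 B ^+ 2) / fnorm A ^+ 2 *
      sigma_min A ^+ 2 * sigma_min B ^+ 2.

(* Main.v *)
Require Import Defs.
From HB Require Import structures.
From mathcomp Require Import all_boot all_order all_algebra.
From mathcomp Require Import all_classical all_reals all_analysis.
From mathcomp Require Import measurable_realfun.
From mathcomp Require Import ring lra.

Set Implicit Arguments.
Unset Strict Implicit.
Unset Printing Implicit Defensive.

Import Order.TTheory GRing.Theory Num.Theory.
Import numFieldNormedType.Exports.

Local Open Scope classical_set_scope.
Local Open Scope ring_scope.

(** The contraction holds along every path, before any expectation is taken.
Write R for the current residual, E = X^k - Y for the error with respect to a
solution Y, and rho_i for the ratio of |R_i|^2 to |A_i|^2.  Expanding the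
square, a step with row i changes |E|^2 by at most - c * rho_i, where
c = 2 alpha - alpha^2 |B|^2 is positive ([grbk_step_fnorm]).  Every row of the
greedy set satisfies rho_i >= gamma by definition, and gamma >= phi_{1/2} |R|^2
because the sum of the rho_i |A_i|^2 is at most the largest ratio times the
denominator occurring in phi ([gamma_ge_phi]).  Finally R = - A E B, and E stays
of the form A^T W B^T, so |R| >= sigma_min(A) sigma_min(B) |E|
([sigma_min_sandwich]).  Hence |E|^2 is multiplied by at most delta_{k,1/2} at
each step that selects a greedy row.

Rows outside the greedy set have probability zero, and up to time k there are
only finitely many histories, so almost every path is greedy.  The conditional
bound, the bound by the product of the (random) factors and the bound by
delta^(k+1) are therefore obtained by integrating inequalities that hold almost
surely.  The product bound in particular needs the pathwise form: an estimate
of the conditional expectations alone would not suffice, since the factors are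
correlated with the errors.  The factors are nonnegative because the error never
vanishes while the ratios differ.

The limit is Y = X^0 + A^+ (C - A X^0 B) B^+, which solves the equation and makes
the initial error of the form A^T W B^T.  On such matrices E = A^+ (A E B) B^+,
which bounds |E| by a multiple of |A E B| even if A or B is rank deficient and
sigma_min vanishes; this gives a geometric rate for every initial guess
([grbk_error_geometric]).  Under the range conditions X^0 itself has this form,
the terms in X^0 cancel and Y = A^+ C B^+; it is orthogonal to the differences of
solutions, hence the unique one of minimum norm ([min_norm_solution_mp]). *)

(** * Frobenius inner product and norm *)

Section Frobenius.
Context {R : realType}.

Definition fdot m n (M N : 'M[R]_(m, n)) : R := \tr (M *m N^T).

Lemma fdotE m n (M N : 'M[R]_(m, n)) :
  fdot M N = \sum_i \sum_j M i j * N i j.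
Proof.
rewrite /fdot /mxtrace; apply: eq_bigr => i _; rewrite mxE.
by apply: eq_bigr => j _; rewrite mxE.
Qed.

Lemma fdotC m n (M N : 'M[R]_(m, n)) : fdot M N = fdot N M.
Proof. by rewrite /fdot -[M in LHS]trmxK -trmx_mul mxtrace_tr. Qed.

Lemma fdotDl m n (M M' N : 'M[R]_(m, n)) :
  fdot (M + M') N = fdot M N + fdot M' N.
Proof. by rewrite /fdot mulmxDl mxtraceD. Qed.

Lemma fdotZl m n (c : R) (M N : 'M[R]_(m, n)) : fdot (c *: M) N = c * fdot M N.
Proof. by rewrite /fdot -scalemxAl mxtraceZ. Qed.

Lemma fdotDr m n (M N N' : 'M[R]_(m, n)) :
  fdot M (N + N') = fdot M N + fdot M N'.
Proof. by rewrite fdotC fdotDl !(fdotC _ M). Qed.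

Lemma fdotZr m n (c : R) (M N : 'M[R]_(m, n)) : fdot M (c *: N) = c * fdot M N.
Proof. by rewrite fdotC fdotZl (fdotC _ M). Qed.

Lemma fdot0l m n (N : 'M[R]_(m, n)) : fdot 0 N = 0.
Proof. by rewrite /fdot mul0mx mxtrace0. Qed.

Lemma fdot_mulmxl m n p (A : 'M[R]_(m, n)) (M : 'M[R]_(n, p)) (N : 'M[R]_(m, p)) :
  fdot (A *m M) N = fdot M (A^T *m N).
Proof. by rewrite /fdot trmx_mul trmxK (mulmxA M) [RHS]mxtrace_mulC mulmxA. Qed.

Lemma fdot_mulmxr m n p (M : 'M[R]_(m, n)) (B : 'M[R]_(n, p)) (N : 'M[R]_(m, p)) :
  fdot (M *m B) N = fdot M (N *m B^T).
Proof. by rewrite /fdot trmx_mul trmxK mulmxA. Qed.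

Lemma fdot_ge0 m n (M : 'M[R]_(m, n)) : 0 <= fdot M M.
Proof.
by rewrite fdotE; do 2![apply: sumr_ge0 => ? _]; rewrite -expr2 sqr_ge0.
Qed.

Lemma fnorm_sqr m n (M : 'M[R]_(m, n)) : fnorm M ^+ 2 = fdot M M.
Proof.
rewrite /fnorm; under eq_bigr do under eq_bigr do rewrite expr2.
by rewrite -fdotE sqr_sqrtr ?fdot_ge0.
Qed.

Lemma fnorm_ge0 m n (M : 'M[R]_(m, n)) : 0 <= fnorm M.
Proof. exact: sqrtr_ge0. Qed.

Lemma fdot_eq0 m n (M : 'M[R]_(m, n)) : (fdot M M == 0) = (M == 0).
Proof.
apply/idP/eqP => [|->]; last by rewrite fdot0l.
rewrite fdotE psumr_eq0 => [/allP h|i _]; last first.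
  by apply: sumr_ge0 => ? _; rewrite -expr2 sqr_ge0.
apply/matrixP => i j; move: (h i (mem_index_enum i)) => /=.
rewrite psumr_eq0 => [/allP/(_ j (mem_index_enum j))/=|k _].
  by rewrite -expr2 sqrf_eq0 mxE => /eqP.
by rewrite -expr2 sqr_ge0.
Qed.

Lemma fnorm_eq0 m n (M : 'M[R]_(m, n)) : (fnorm M == 0) = (M == 0).
Proof. by rewrite -fdot_eq0 -fnorm_sqr sqrf_eq0. Qed.

Lemma fnorm0 m n : fnorm (0 : 'M[R]_(m, n)) = 0.
Proof. by apply/eqP; rewrite fnorm_eq0. Qed.

Lemma fnorm_gt0 m n (M : 'M[R]_(m, n)) : (0 < fnorm M) = (M != 0).
Proof. by rewrite lt_neqAle fnorm_ge0 andbT eq_sym fnorm_eq0. Qed.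

Lemma fnorm_tr m n (M : 'M[R]_(m, n)) : fnorm M^T = fnorm M.
Proof.
rewrite /fnorm exchange_big; congr Num.sqrt.
by do 2![apply: eq_bigr => ? _]; rewrite mxE.
Qed.

Lemma fnormZ_sqr m n c (M : 'M[R]_(m, n)) :
  fnorm (c *: M) ^+ 2 = c ^+ 2 * fnorm M ^+ 2.
Proof. by rewrite !fnorm_sqr fdotZl fdotZr mulrA expr2. Qed.

Lemma fnormD_sqr m n (M N : 'M[R]_(m, n)) :
  fnorm (M + N) ^+ 2 = fnorm M ^+ 2 + 2 * fdot M N + fnorm N ^+ 2.
Proof.
rewrite !fnorm_sqr fdotDl !fdotDr [fdot N M]fdotC.
by rewrite mulrDl mul1r !addrA.
Qed.

Lemma fnorm_rows m n (M : 'M[R]_(m, n)) :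
  fnorm M ^+ 2 = \sum_i fnorm (row i M) ^+ 2.
Proof.
rewrite fnorm_sqr fdotE; apply: eq_bigr => i _.
by rewrite fnorm_sqr fdotE big_ord1; apply: eq_bigr => j _; rewrite mxE.
Qed.

Lemma fnorm_cols m n (M : 'M[R]_(m, n)) :
  fnorm M ^+ 2 = \sum_j fnorm (col j M) ^+ 2.
Proof.
rewrite -fnorm_tr fnorm_rows; apply: eq_bigr => j _.
by rewrite -fnorm_tr tr_row trmxK.
Qed.

(** The square of the component of M orthogonal to N, scaled by |N|^2 to avoid
the division, is nonnegative. *)
Lemma fdot_CauchySchwarz m n (M N : 'M[R]_(m, n)) :
  fdot M N ^+ 2 <= fnorm M ^+ 2 * fnorm N ^+ 2.
Proof.
have [->|N0] := eqVneq N 0; first by rewrite fdotC fdot0l fnorm0 !expr0n mulr0.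
have b0 : 0 < fnorm N ^+ 2 by rewrite exprn_gt0 // fnorm_gt0.
have := sqr_ge0 (fnorm (fnorm N ^+ 2 *: M + (- fdot M N) *: N)).
rewrite fnormD_sqr !fnormZ_sqr fdotZl fdotZr.
set a := fnorm M ^+ 2; set b := fnorm N ^+ 2; set c := fdot M N.
have -> : b ^+ 2 * a + 2 * (b * (- c * c)) + (- c) ^+ 2 * b
        = b * (a * b - c ^+ 2) by ring.
by rewrite pmulr_rge0 // subr_ge0.
Qed.

(** Cauchy-Schwarz for each entry of the product, then summation. *)
Lemma fnorm_mulmx m n p (M : 'M[R]_(m, n)) (N : 'M[R]_(n, p)) :
  fnorm (M *m N) ^+ 2 <= fnorm M ^+ 2 * fnorm N ^+ 2.
Proof.
rewrite [in leLHS]fnorm_sqr fdotE (fnorm_rows M) (fnorm_cols N) mulr_suml.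
apply: ler_sum => i _; rewrite mulr_sumr; apply: ler_sum => j _.
rewrite -expr2 -(fnorm_tr (col j N)); apply: le_trans (fdot_CauchySchwarz _ _).
rewrite fdotE big_ord1 mxE le_eqVlt; apply/orP; left; apply/eqP.
by congr (_ ^+ 2); apply: eq_bigr => k _; rewrite !mxE.
Qed.

Lemma fnorm_outer m n (a : 'rV[R]_m) (r : 'rV[R]_n) :
  fnorm (a^T *m r) ^+ 2 = fnorm a ^+ 2 * fnorm r ^+ 2.
Proof.
rewrite 3!fnorm_sqr fdot_mulmxl trmxK mulmxA fdotE big_ord1 [fdot r r]fdotE.
rewrite big_ord1 mulr_sumr; apply: eq_bigr => j _.
have -> : a *m a^T = (fdot a a)%:M.
  by rewrite [LHS]mx11_scalar /fdot /mxtrace big_ord1.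
by rewrite mul_scalar_mx mxE; ring.
Qed.

Lemma mulmx_trmx_eq0 m n (M : 'M[R]_(m, n)) : (M *m M^T == 0) = (M == 0).
Proof.
apply/idP/eqP => [/eqP h|->]; last by rewrite mul0mx.
by apply/eqP; rewrite -fdot_eq0 /fdot h mxtrace0.
Qed.

End Frobenius.

(** * Moore-Penrose inverse *)

Section MoorePenrose.
Context {R : realType}.

(** If K M M^T = 0 then |K M|^2 = tr (K M M^T K^T) = 0, so over the reals M M^T and
M have the same left kernel. *)
Lemma row_free_gram_unit m n (M : 'M[R]_(m, n)) :
  row_free M -> M *m M^T \in unitmx.
Proof.
move=> fM; rewrite -row_free_unit -kermx_eq0; apply/eqP.
set K := kermx _.
have : K *m M *m (K *m M)^T = 0.
  by rewrite trmx_mul mulmxA -(mulmxA K) mulmx_ker mul0mx.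
move/eqP; rewrite mulmx_trmx_eq0 => /eqP KM.
by apply/(row_free_inj fM); rewrite mul0mx.
Qed.

Lemma moore_penrose_factor m r n (L : 'M[R]_(m, r)) (U : 'M[R]_(r, n)) :
  L^T *m L \in unitmx -> U *m U^T \in unitmx ->
  is_moore_penrose (L *m U)
    (U^T *m invmx (U *m U^T) *m invmx (L^T *m L) *m L^T).
Proof.
move=> LL UU; set GU := invmx (U *m U^T); set GL := invmx (L^T *m L).
have GUT : GU^T = GU by rewrite /GU trmx_inv trmx_mul trmxK.
have GLT : GL^T = GL by rewrite /GL trmx_inv trmx_mul trmxK.
have MP : L *m U *m (U^T *m GU *m GL *m L^T) = L *m GL *m L^T.
  by rewrite -!mulmxA !(mulmxA U) mulKVmx.
have PM : U^T *m GU *m GL *m L^T *m (L *m U) = U^T *m GU *m U.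
  by rewrite -!mulmxA (mulmxA L^T) mulKmx.
split.
- by rewrite MP -!mulmxA (mulmxA L^T) mulKmx.
- by rewrite PM -!mulmxA !(mulmxA U) mulKVmx.
- by rewrite MP !trmx_mul trmxK GLT mulmxA.
- by rewrite PM !trmx_mul trmxK GUT mulmxA.
Qed.

(** A rank factorization M = L U always exists: L has independent columns and U
independent rows, so both Gram matrices are invertible. *)
Lemma moore_penrose_exists m n (M : 'M[R]_(m, n)) :
  exists P, is_moore_penrose M P.
Proof.
eexists; rewrite -{1}(mulmx_base M); apply: moore_penrose_factor.
  rewrite -{2}[col_base M]trmxK row_free_gram_unit // /row_free mxrank_tr.
  by have := col_base_full M; rewrite /row_full.
by rewrite row_free_gram_unit ?row_base_free.
Qed.

Lemma mp_inverseP m n (M : 'M[R]_(m, n)) : is_moore_penrose M (mp_inverse M).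
Proof. by apply: (@xgetPex _ 0); exact: moore_penrose_exists. Qed.

Local Notation "M ^+" := (mp_inverse M) (at level 8, format "M ^+").

Lemma mp_inverseK_tr m n (M : 'M[R]_(m, n)) : M^+ *m M *m M^T = M^T.
Proof.
have [MPM _ _ sPM] := mp_inverseP M.
by rewrite -sPM -trmx_mul mulmxA MPM.
Qed.

Lemma mp_inverse_trK m n (M : 'M[R]_(m, n)) : M^T *m (M *m M^+) = M^T.
Proof.
have [MPM _ sMP _] := mp_inverseP M.
by rewrite -sMP -trmx_mul MPM.
Qed.

(** This and the next lemma exhibit the range and the row space of the
pseudoinverse: they are those of the transpose. *)
Lemma mp_inverse_trl m n (M : 'M[R]_(m, n)) : M^T *m (M^+^T *m M^+) = M^+.
Proof.
have [_ PMP _ sPM] := mp_inverseP M.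
by rewrite mulmxA -trmx_mul sPM PMP.
Qed.

Lemma mp_inverse_trr m n (M : 'M[R]_(m, n)) : M^+ *m M^+^T *m M^T = M^+.
Proof.
have [_ PMP sMP _] := mp_inverseP M.
by rewrite -mulmxA -trmx_mul sMP mulmxA PMP.
Qed.

End MoorePenrose.

(** * Spectral norm and smallest singular value *)

Section SingularValues.
Context {R : realType}.

Lemma fnormZ m n c (M : 'M[R]_(m, n)) : fnorm (c *: M) = `|c| * fnorm M.
Proof.
apply/eqP; rewrite -(@eqrXn2 _ 2) ?mulr_ge0 ?fnorm_ge0 //.
by rewrite fnormZ_sqr exprMn real_normK // num_real.
Qed.

Lemma fnorm_normalize m n (M : 'M[R]_(m, n)) : M != 0 ->
  fnorm ((fnorm M)^-1 *: M) = 1.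
Proof.
by move=> M0; rewrite fnormZ ger0_norm ?invr_ge0 ?fnorm_ge0 // mulVf // fnorm_eq0.
Qed.

Lemma norm2_le m n (M : 'M[R]_(m, n)) (x : 'cV[R]_n) :
  fnorm (M *m x) <= norm2 M * fnorm x.
Proof.
have [->|x0] := eqVneq x 0; first by rewrite mulmx0 !fnorm0 mulr0.
rewrite -ler_pdivrMr ?fnorm_gt0 //; apply: ub_le_sup; last first.
  exists ((fnorm x)^-1 *: x) => /=; first by rewrite fnorm_normalize.
  by rewrite -scalemxAr fnormZ ger0_norm ?invr_ge0 ?fnorm_ge0 // mulrC.
exists (fnorm M) => _ [y y1 <-].
rewrite -(@ler_pXn2r _ 2) ?nnegrE ?fnorm_ge0 //.
apply: le_trans (fnorm_mulmx _ _) _.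
by rewrite ler_piMr ?sqr_ge0 // expr_le1 ?fnorm_ge0.
Qed.

Lemma continuous_fnorm_mulmx_sqr n m (M : 'M[R]_(n, m)) :
  continuous (fun x : 'rV[R]_n => fnorm (x *m M) ^+ 2).
Proof.
have -> : (fun x : 'rV[R]_n => fnorm (x *m M) ^+ 2) =
    (fun x => \sum_j (\sum_k x ord0 k * M k j) ^+ 2).
  apply/funext => x; rewrite fnorm_sqr fdotE big_ord1.
  by apply: eq_bigr => j _; rewrite !mxE expr2.
apply: continuous_big => [|j _]; first exact: add_continuous.
move=> x; apply: (@continuous_comp _ _ _ _ (fun y : R => y ^+ 2)); last first.
  exact: exprn_continuous.
move: x; apply: continuous_big => [|k _]; first exact: add_continuous.
move=> x; apply: (@continuousM _ 'rV[R]_n (fun x => x ord0 k) (fun=> M k j)).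
  exact: coord_continuous.
exact: cst_continuous.
Qed.

Lemma compact_sphere n : compact [set x : 'rV[R]_n | fnorm x ^+ 2 = 1].
Proof.
have box : compact [set v : 'rV[R]_n | forall i, v ord0 i \in `[(-1), 1]].
  apply: (@rV_compact _ n (fun=> `[(-1 : R), 1]%classic)) => _.
  exact: segment_compact.
apply: subclosed_compact box _.
  have c := @continuous_fnorm_mulmx_sqr n n 1%:M.
  rewrite (_ : [set _ | _] =
      (fun x : 'rV[R]_n => fnorm (x *m 1%:M) ^+ 2) @^-1` [set 1]).
    by apply: preimage_closed => [x _|]; [exact: c|exact: closed_eq].
  by apply/seteqP; split=> x /=; rewrite mulmx1.
move=> x /= x1 i; rewrite in_itv /= -ler_norml.
rewrite -(@ler_pXn2r _ 2) ?nnegrE // expr1n real_normK ?num_real // -x1.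
rewrite fnorm_sqr fdotE big_ord1 (bigD1 i) //= expr2 lerDl.
by apply: sumr_ge0 => j _; rewrite -expr2 sqr_ge0.
Qed.

(** First-order condition at a minimum.  The proof evaluates the hypothesis at
t = - a / d with d > |b|, where the linear term outweighs the quadratic one. *)
Lemma linear_vanish (a b : R) : (forall t, 0 <= 2 * t * a + t ^+ 2 * b) -> a = 0.
Proof.
move=> h; apply/eqP; rewrite -sqrf_eq0; apply/eqP/le_anti; rewrite sqr_ge0 andbT.
have b0 : 0 <= `|b| := normr_ge0 b.
pose d := `|b| + 1; have d0 : 0 < d by rewrite /d; lra.
have /= := h (- a / d).
have -> : 2 * (- a / d) * a + (- a / d) ^+ 2 * b = (a ^+ 2 * (b - 2 * d)) / d ^+ 2.
  by field; rewrite gt_eqF.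
rewrite pmulr_lge0 ?invr_gt0 ?exprn_gt0 // => h'.
have b1 : b <= `|b| := ler_norm b.
have : b - 2 * d < 0 by rewrite /d; lra.
by move=> neg; rewrite -(nmulr_lge0 _ neg).
Qed.

(** The least gain of M on the unit sphere is attained by compactness.  At a
minimizer x the form y |-> |y M|^2 - |x M|^2 |y|^2 is nonnegative and vanishes at
x, so its gradient vanishes there: x is an eigenvector of M M^T. *)
Lemma min_gain_exists n m (M : 'M[R]_(n, m)) : (0 < n)%N ->
  exists x : 'rV[R]_n, [/\ fnorm x = 1,
    x *m M *m M^T = fnorm (x *m M) ^+ 2 *: x &
    forall y : 'rV[R]_n, fnorm (x *m M) * fnorm y <= fnorm (y *m M)].
Proof.
case: n M => // n M _.
have S0 : [set x : 'rV[R]_n.+1 | fnorm x ^+ 2 = 1] !=set0.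
  exists (delta_mx ord0 ord0) => /=.
  rewrite fnorm_sqr fdotE big_ord1 (bigD1 ord0) //= big1 ?mxE ?mulr1 ?addr0 //.
  by move=> i i0; rewrite mxE (negbTE i0) mul0r.
have [x] := EVT_min_rV S0 (@compact_sphere n.+1)
  (continuous_subspaceT (@continuous_fnorm_mulmx_sqr _ _ M)).
rewrite inE /= => x1 minx.
have ge (y : 'rV[R]_n.+1) :
    fnorm (x *m M) ^+ 2 * fnorm y ^+ 2 <= fnorm (y *m M) ^+ 2.
  have [->|y0] := eqVneq y 0; first by rewrite mul0mx !fnorm0 expr0n mulr0.
  have := minx ((fnorm y)^-1 *: y); rewrite inE /=.
  rewrite fnorm_normalize // expr1n => /(_ erefl).
  rewrite -scalemxAl fnormZ_sqr mulrC exprVn ler_pdivlMr //.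
  by rewrite exprn_gt0 // fnorm_gt0.
exists x; split.
- by apply/eqP; rewrite -(@eqrXn2 _ 2) ?fnorm_ge0 // x1 expr1n.
  (* Perturbing x in the direction z of the gradient itself shows that the
     derivative 2 |z|^2 is zero. *)
- apply/eqP; rewrite -subr_eq0 -fdot_eq0; move zE: (_ - _) => z; apply/eqP.
  apply: (@linear_vanish _ (fnorm (z *m M) ^+ 2 -
                            fnorm (x *m M) ^+ 2 * fnorm z ^+ 2)) => t.
  have := ge (x + t *: z).
  rewrite mulmxDl -scalemxAl !fnormD_sqr !fnormZ_sqr !fdotZr x1.
  have -> : fdot (x *m M) (z *m M) = fdot (x *m M *m M^T) z.
    by rewrite fdotC fdot_mulmxr fdotC.
  have -> : x *m M *m M^T = z + fnorm (x *m M) ^+ 2 *: x by rewrite -zE subrK.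
  rewrite fdotDl fdotZl -subr_ge0.
  move=> h; apply: (le_trans h); rewrite le_eqVlt; apply/orP; left; apply/eqP; ring.
- move=> y; rewrite -(@ler_pXn2r _ 2) ?nnegrE ?mulr_ge0 ?fnorm_ge0 //.
  by rewrite exprMn.
Qed.

Lemma singular_value_tr m n (M : 'M[R]_(m, n)) s :
  singular_value M^T s -> singular_value M s.
Proof.
move=> [s0 [u [v [u1 v1 Mv Mu]]]]; split=> //.
by exists v, u; split; rewrite ?trmxK in Mu *.
Qed.

Lemma sigma_min_tr m n (M : 'M[R]_(m, n)) : sigma_min M^T = sigma_min M.
Proof.
congr inf; apply/seteqP; split=> s /=; first exact: singular_value_tr.
by move=> sM; apply: singular_value_tr; rewrite trmxK.
Qed.

Lemma sigma_min_ge0 m n (M : 'M[R]_(m, n)) : 0 <= sigma_min M.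
Proof.
rewrite /sigma_min; have [->|/set0P ne] := eqVneq [set s | singular_value M s] set0.
  by rewrite inf0.
by apply: lb_le_inf => // s [].
Qed.

Lemma sigma_min_le m n (M : 'M[R]_(m, n)) s :
  singular_value M s -> sigma_min M <= s.
Proof. by move=> sM; apply: ge_inf => //; exists 0 => t []. Qed.

(** The least gain is a singular value, hence dominates the smallest one.  If it
is positive, the right singular vector is x M normalized; if it is zero, M has
rank less than n <= m and any unit vector of its right kernel will do. *)
Lemma sigma_min_le_gain n m (M : 'M[R]_(n, m)) (y : 'rV[R]_n) :
  (0 < n <= m)%N -> sigma_min M * fnorm y <= fnorm (y *m M).
Proof.
move=> /andP[n0 nm]; have [x [x1 xMM gain]] := min_gain_exists M n0.
apply: le_trans (gain y); rewrite ler_wpM2r ?fnorm_ge0 //.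
apply: sigma_min_le; split; first exact: fnorm_ge0.
have [xM|xM] := eqVneq (x *m M) 0.
  have /rowV0Pn[v vk v0] : kermx M^T != 0.
    rewrite kermx_eq0 /row_free mxrank_tr neq_ltn; apply/orP; left.
    apply: leq_trans nm; rewrite ltn_neqAle rank_leq_row andbT.
    apply/negP => /row_free_inj/(_ x 0); rewrite xM mul0mx => /(_ erefl) x0.
    by move: x1; rewrite x0 fnorm0 => /eqP; rewrite eq_sym oner_eq0.
  have vM : M *m v^T = 0.
    by apply: trmx_inj; rewrite trmx_mul trmxK trmx0; apply/sub_kermxP.
  exists x^T, ((fnorm v)^-1 *: v)^T; split; rewrite ?fnorm_tr //.
  - exact: fnorm_normalize.
  - by rewrite xM fnorm0 scale0r linearZ /= -scalemxAr vM scaler0.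
  - by rewrite xM fnorm0 scale0r -trmx_mul xM trmx0.
have s0 : fnorm (x *m M) != 0 by rewrite fnorm_eq0.
exists x^T, ((fnorm (x *m M))^-1 *: (x *m M))^T; split; rewrite ?fnorm_tr //.
- exact: fnorm_normalize.
- rewrite linearZ /= -scalemxAr.
  have -> : M *m (x *m M)^T = (x *m M *m M^T)^T by rewrite [RHS]trmx_mul trmxK.
  by rewrite xMM linearZ /= scalerA expr2 mulKf.
- by rewrite -trmx_mul linearZ /= scalerA mulfV // scale1r.
Qed.

(** With singular values counted up to min(m, n), the bound |M x| >= sigma |x| may
fail on the kernel of M when m < n, but it holds on the range of M^T.  A tall M
has the bound everywhere; for a wide M it is transferred from M^T by
|M^T y|^2 = <y, M M^T y> <= |y| |M M^T y|. *)
Lemma sigma_min_range_col m n (M : 'M[R]_(m, n)) (y : 'cV[R]_m) :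
  sigma_min M * fnorm (M^T *m y) <= fnorm (M *m (M^T *m y)).
Proof.
case: m M y => [|m] M y.
  by rewrite (flatmx0 y) !mulmx0 !fnorm0 mulr0.
case: n M => [|n] M.
  by rewrite (flatmx0 M^T) mul0mx mulmx0 !fnorm0 mulr0.
have [mn|nm] := leqP m.+1 n.+1; last first.
  have := @sigma_min_le_gain _ _ M^T (M^T *m y)^T (ltnW nm).
  by rewrite sigma_min_tr -trmx_mul !fnorm_tr.
have := @sigma_min_le_gain _ _ M y^T mn.
rewrite -{2}[M]trmxK -trmx_mul !fnorm_tr => gain.
have [->|w0] := eqVneq (M^T *m y) 0; first by rewrite mulmx0 !fnorm0 mulr0.
set w := M^T *m y in w0 gain *.
have w_gt0 : 0 < fnorm w by rewrite fnorm_gt0.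
have cs : fnorm w ^+ 2 <= fnorm y * fnorm (M *m w).
  rewrite -(@ler_pXn2r _ 2) ?nnegrE ?mulr_ge0 ?fnorm_ge0 ?sqr_ge0 //.
  rewrite {1}fnorm_sqr {1}/w fdot_mulmxl trmxK exprMn.
  exact: fdot_CauchySchwarz.
rewrite -(ler_pM2r w_gt0) -mulrA -expr2.
apply: le_trans (ler_wpM2l (sigma_min_ge0 M) cs) _.
by rewrite mulrA mulrC ler_wpM2l ?fnorm_ge0.
Qed.

Lemma sigma_min_range m n k (M : 'M[R]_(m, n)) (W : 'M[R]_(m, k)) :
  sigma_min M ^+ 2 * fnorm (M^T *m W) ^+ 2 <= fnorm (M *m (M^T *m W)) ^+ 2.
Proof.
rewrite !fnorm_cols mulr_sumr; apply: ler_sum => j _.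
rewrite !colE -!mulmxA -exprMn.
rewrite ler_pXn2r ?nnegrE ?mulr_ge0 ?fnorm_ge0 ?sigma_min_ge0 //.
exact: sigma_min_range_col.
Qed.

(** The columns of E B lie in the range of A^T and the rows of E in the row space
of B^T, so the previous bound applies once to A and once to B^T. *)
Lemma sigma_min_sandwich m p q n (A : 'M[R]_(m, p)) (B : 'M[R]_(q, n))
    (W : 'M[R]_(m, n)) (E := A^T *m W *m B^T) :
  sigma_min A ^+ 2 * sigma_min B ^+ 2 * fnorm E ^+ 2 <= fnorm (A *m E *m B) ^+ 2.
Proof.
have hA := sigma_min_range A (W *m B^T *m B).
have hB := sigma_min_range B^T (W^T *m A).
rewrite sigma_min_tr trmxK in hB.
have e1 : fnorm (B *m (W^T *m A)) = fnorm E.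
  by rewrite -fnorm_tr !trmx_mul trmxK.
have e2 : fnorm (B^T *m (B *m (W^T *m A))) = fnorm (E *m B).
  by rewrite -fnorm_tr !trmx_mul !trmxK.
rewrite e1 e2 in hB; rewrite -!mulmxA !(mulmxA _ B^T) in hA *.
rewrite -mulrA; apply: le_trans (ler_wpM2l (sqr_ge0 _) hB) _.
by apply: le_trans hA; rewrite /E -!mulmxA.
Qed.

End SingularValues.

(** * The limit of the method *)

Section Limit.
Context {R : realType} {m p q n : nat}.
Variables (A : 'M[R]_(m, p)) (B : 'M[R]_(q, n)) (C : 'M[R]_(m, n)).

(** The matrices A^T W B^T are the orthogonal complement of the solutions of the
homogeneous equation A X B = 0.  Each update of the method belongs to this
space. *)
Definition normal_range (E : 'M[R]_(p, q)) := exists W, E = A^T *m W *m B^T.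

(** The orthogonal projection of the initial guess on the affine space of the
solutions, when there are any. *)
Definition grbk_limit (X0 : 'M[R]_(p, q)) :=
  X0 + mp_inverse A *m (C - A *m X0 *m B) *m mp_inverse B.

Lemma normal_range_mp (W : 'M[R]_(m, n)) :
  normal_range (mp_inverse A *m W *m mp_inverse B).
Proof.
exists ((mp_inverse A)^T *m mp_inverse A *m W *m
        (mp_inverse B *m (mp_inverse B)^T)).
by rewrite -[in LHS](mp_inverse_trl A) -[in LHS](mp_inverse_trr B) !mulmxA.
Qed.

Lemma mp_normal_range E : normal_range E ->
  mp_inverse A *m (A *m E *m B) *m mp_inverse B = E.
Proof.
move=> [W ->]; rewrite !mulmxA mp_inverseK_tr -!mulmxA.
by rewrite mp_inverse_trK.
Qed.

Lemma normal_rangeN E : normal_range E -> normal_range (- E).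
Proof. by move=> [W ->]; exists (- W); rewrite mulmxN mulNmx. Qed.

Lemma range_sub_normal_range X :
  range_sub X A^T -> range_sub X^T B -> normal_range X.
Proof.
rewrite /range_sub !trmxK => /submxP[D XD] /submxP[D' XD'].
have XA : mp_inverse A *m A *m X = X.
  by rewrite -[X]trmxK XD trmx_mul mulmxA mp_inverseK_tr.
have XB : X *m (B *m mp_inverse B) = X.
  by rewrite XD' -mulmxA mp_inverse_trK.
have -> : X = mp_inverse A *m (A *m X *m B) *m mp_inverse B.
  by rewrite !mulmxA XA -mulmxA XB.
exact: normal_range_mp.
Qed.

(** A replacement for the singular value bound that keeps a positive constant for
matrices of deficient rank. *)
Lemma normal_range_fnorm E : normal_range E ->
  fnorm E ^+ 2 <= (fnorm (mp_inverse A) * fnorm (mp_inverse B)) ^+ 2 *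
                  fnorm (A *m E *m B) ^+ 2.
Proof.
move=> /mp_normal_range {1}<-; apply: le_trans (fnorm_mulmx _ _) _.
rewrite exprMn [leRHS]mulrAC ler_wpM2r ?sqr_ge0 //; exact: fnorm_mulmx.
Qed.

Hypothesis consistent : exists X, solution A B C X.

Lemma mp_consistent : A *m mp_inverse A *m C *m (mp_inverse B *m B) = C.
Proof.
have [X <-] := consistent; have [AA _ _ _] := mp_inverseP A.
have [BB _ _ _] := mp_inverseP B.
by rewrite !mulmxA AA -!mulmxA (mulmxA B) BB.
Qed.

Lemma solution_grbk_limit X0 : solution A B C (grbk_limit X0).
Proof.
rewrite /solution /grbk_limit mulmxDr mulmxDl.
have [AA _ _ _] := mp_inverseP A; have [BB _ _ _] := mp_inverseP B.
have -> : A *m (mp_inverse A *m (C - A *m X0 *m B) *m mp_inverse B) *m B =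
    C - A *m X0 *m B; last by rewrite addrC subrK.
rewrite mulmxBr mulmxBl mulmxBr mulmxBl; congr (_ - _).
  by rewrite -[RHS]mp_consistent !mulmxA.
by rewrite !mulmxA AA -!mulmxA (mulmxA B) BB.
Qed.

Lemma normal_range_init X0 : normal_range (X0 - grbk_limit X0).
Proof.
rewrite /grbk_limit opprD addrA subrr add0r.
exact/normal_rangeN/normal_range_mp.
Qed.

Lemma grbk_limit_normal_range X0 : normal_range X0 ->
  grbk_limit X0 = mp_inverse A *m C *m mp_inverse B.
Proof.
move=> X0n; rewrite /grbk_limit mulmxBr mulmxBl (mp_normal_range X0n).
by rewrite addrC subrK.
Qed.

(** A^+ C B^+ belongs to the space A^T W B^T, which is orthogonal to the
differences of solutions; Pythagoras gives minimality and uniqueness. *)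
Lemma min_norm_solution_mp Y :
  min_norm_solution A B C Y <-> Y = mp_inverse A *m C *m mp_inverse B.
Proof.
set Xs := _ *m mp_inverse B.
have solXs : solution A B C Xs.
  by rewrite /solution -[RHS]mp_consistent /Xs !mulmxA.
have pythagoras Z : solution A B C Z ->
    fnorm Z ^+ 2 = fnorm Xs ^+ 2 + fnorm (Z - Xs) ^+ 2.
  move=> solZ; have orth : fdot Xs (Z - Xs) = 0.
    have [W XsW] : normal_range Xs by exact: normal_range_mp.
    rewrite {1}XsW fdot_mulmxr trmxK fdot_mulmxl trmxK mulmxA.
    by rewrite mulmxBr mulmxBl solZ solXs subrr fdotC fdot0l.
  rewrite -[Z in LHS](subrK Xs) (addrC (Z - Xs) Xs) (fnormD_sqr Xs (Z - Xs)).
  by rewrite orth mulr0 addr0.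
split=> [[solY minY]|->]; last first.
  split=> // Z /pythagoras solZ; rewrite -(@ler_pXn2r _ 2) ?nnegrE ?fnorm_ge0 //.
  by rewrite solZ lerDl sqr_ge0.
apply/eqP; rewrite -subr_eq0 -fnorm_eq0 -sqrf_eq0.
rewrite eq_le sqr_ge0 andbT -(lerD2l (fnorm Xs ^+ 2)) -pythagoras // addr0.
by rewrite ler_pXn2r ?nnegrE ?fnorm_ge0 // minY.
Qed.

End Limit.

(** * The greedy selection rule *)

Section Greedy.
Context {R : realType} {m p n : nat}.
Variables (A : 'M[R]_(m, p)) (S : 'M[R]_(m, n)).
Hypothesis A_rows : forall i, row i A != 0.

Lemma row_sqr_gt0 i : 0 < fnorm (row i A) ^+ 2.
Proof. by rewrite exprn_gt0 // fnorm_gt0. Qed.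

Lemma row_ratio_ge0 i : 0 <= row_ratio A S i.
Proof. by rewrite divr_ge0 ?sqr_ge0. Qed.

Lemma row_ratio_le_max i : row_ratio A S i <= max_ratio A S.
Proof. exact: le_bigmax. Qed.

Lemma mean_ratio_ge0 : 0 <= mean_ratio A S.
Proof.
by rewrite mulr_ge0 ?invr_ge0 ?ler0n ?sumr_ge0 // => i _; exact: row_ratio_ge0.
Qed.

Lemma fnorm_residual : fnorm S ^+ 2 =
  \sum_i row_ratio A S i * fnorm (row i A) ^+ 2.
Proof.
by rewrite fnorm_rows; apply: eq_bigr => i _; rewrite divfK // gt_eqF // row_sqr_gt0.
Qed.

Section NonEmpty.
Variable i0 : 'I_m.

Let m_gt0 : 0 < m%:R :> R.
Proof. by rewrite ltr0n (leq_ltn_trans _ (ltn_ord i0)). Qed.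

Lemma fnormA_sqr_gt0 : 0 < fnorm A ^+ 2.
Proof.
rewrite fnorm_rows (bigD1 i0) //= ltr_pwDl ?row_sqr_gt0 //.
by apply: sumr_ge0 => *; exact: sqr_ge0.
Qed.

Lemma mean_ratio_le_max : mean_ratio A S <= max_ratio A S.
Proof.
rewrite /mean_ratio ler_pdivrMl // mulr_natl.
have -> : max_ratio A S *+ m = \sum_(i < m) max_ratio A S.
  by rewrite sumr_const card_ord.
by apply: ler_sum => i _; exact: row_ratio_le_max.
Qed.

(** Not all ratios can lie strictly below their mean. *)
Lemma Omega_proper : exists i, i \notin Omega A S.
Proof.
apply/existsP; rewrite -negb_forall; apply/negP => /forallP all_Omega.
have : \sum_i row_ratio A S i < \sum_(i < m) mean_ratio A S.
  apply: ltr_sum => [|i _]; first by apply/hasP; exists i0; rewrite ?mem_index_enum.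
  by have := all_Omega i; rewrite inE.
by rewrite sumr_const card_ord -mulr_natl mulVKf ?gt_eqF // ltxx.
Qed.

Lemma max_ratio_ge0 : 0 <= max_ratio A S.
Proof. exact: le_trans (row_ratio_ge0 i0) (row_ratio_le_max i0). Qed.

Lemma eps_ge0 : 0 <= eps A S.
Proof. by rewrite divr_ge0 ?mean_ratio_ge0 ?max_ratio_ge0. Qed.

Lemma eps_le1 : eps A S <= 1.
Proof.
have [M0|M0] := eqVneq (max_ratio A S) 0; first by rewrite /eps M0 invr0 mulr0.
by rewrite ler_pdivrMr ?mul1r ?mean_ratio_le_max // lt_neqAle eq_sym M0 max_ratio_ge0.
Qed.

(** When all ratios vanish, [eps] is a division by zero, but both sides are zero. *)
Lemma mean_ratio_eps : mean_ratio A S = eps A S * max_ratio A S.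
Proof.
have [M0|M0] := eqVneq (max_ratio A S) 0; last by rewrite divfK.
rewrite M0 mulr0; apply/le_anti; rewrite mean_ratio_ge0 andbT -M0.
exact: mean_ratio_le_max.
Qed.

Definition phi_denominator :=
  \sum_(i < m | i \notin Omega A S) fnorm (row i A) ^+ 2 +
  eps A S * \sum_(i < m | i \in Omega A S) fnorm (row i A) ^+ 2.

Lemma phi_denominator_gt0 : 0 < phi_denominator.
Proof.
have [j jO] := Omega_proper.
rewrite /phi_denominator (bigD1 j) //= -addrA ltr_pwDl ?row_sqr_gt0 // addr_ge0 //.
  by apply: sumr_ge0 => *; exact: sqr_ge0.
by rewrite mulr_ge0 ?eps_ge0 //; apply: sumr_ge0 => *; exact: sqr_ge0.
Qed.

Lemma phi_denominator_le : phi_denominator <= fnorm A ^+ 2.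
Proof.
rewrite /phi_denominator (fnorm_rows A).
rewrite [leRHS](bigID (fun i => i \notin Omega A S)) /= lerD2l.
under [leRHS]eq_bigl do rewrite negbK.
by rewrite ler_piMl ?eps_le1 //; apply: sumr_ge0 => *; exact: sqr_ge0.
Qed.

Lemma phi_half_ge : (fnorm A ^+ 2)^-1 <= phi A S 2^-1.
Proof.
have : (fnorm A ^+ 2)^-1 <= phi_denominator^-1.
  by rewrite lef_pV2 ?phi_denominator_le // posrE ?phi_denominator_gt0 ?fnormA_sqr_gt0.
by rewrite /phi -/phi_denominator; lra.
Qed.

(** In the sum of the |R_i|^2 = rho_i |A_i|^2, ratios outside [Omega] are bounded by
the largest one and those in [Omega] by the mean, which is [eps] times the
largest one. *)
Lemma fnorm_residual_le : fnorm S ^+ 2 <= max_ratio A S * phi_denominator.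
Proof.
rewrite fnorm_residual /phi_denominator mulrDr mulrA [_ * eps _ _]mulrC -mean_ratio_eps.
rewrite (bigID (fun i => i \notin Omega A S)) /= !mulr_sumr lerD //.
  by apply: ler_sum => i _; rewrite ler_wpM2r ?sqr_ge0 ?row_ratio_le_max.
under eq_bigl do rewrite negbK.
apply: ler_sum => i; rewrite inE => lt; rewrite ler_wpM2r ?sqr_ge0 //.
exact: ltW.
Qed.

(** [gamma] and [phi] with parameter 1/2 are averages with the same weights, so the
terms are compared separately; the second ones agree. *)
Lemma gamma_ge_phi : phi A S 2^-1 * fnorm S ^+ 2 <= gamma A S.
Proof.
have : phi_denominator^-1 * fnorm S ^+ 2 <= max_ratio A S.
  by rewrite mulrC ler_pdivrMr ?phi_denominator_gt0 // fnorm_residual_le.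
by rewrite /phi -/phi_denominator /gamma; lra.
Qed.

End NonEmpty.

Lemma greedy_row_ratio i : i \in greedy_set A S -> gamma A S <= row_ratio A S i.
Proof. by rewrite inE /row_ratio ler_pdivlMr // row_sqr_gt0. Qed.

Lemma select_prob_greedy i : i \notin greedy_set A S -> select_prob A S i = 0.
Proof.
move=> iJ; rewrite /select_prob (_ : row i _ = 0) ?fnorm0 ?expr0n ?mul0r //.
by apply/rowP => j; rewrite !mxE (negbTE iJ).
Qed.

Lemma residual0_ratios_eq i j : S = 0 -> row_ratio A S i = row_ratio A S j.
Proof. by move=> ->; rewrite /row_ratio !row0 fnorm0 expr0n !mul0r. Qed.

End Greedy.

(** * Contraction of one step *)

Section Step.
Context {R : realType} {m p q n : nat}.
Variables (A : 'M[R]_(m, p)) (B : 'M[R]_(q, n)) (alpha : R).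
Hypothesis A_rows : forall i, row i A != 0.

Local Notation c := (2 * alpha - alpha ^+ 2 * norm2 B ^+ 2).

(** A row of A, transposed, lies in the range of A^T. *)
Lemma grbk_step_normal_range i (X Y : 'M[R]_(p, q)) (S : 'M[R]_(m, n)) :
  normal_range A B (X - Y) ->
  normal_range A B ((grbk_step A B alpha i (X, S)).1 - Y).
Proof.
move=> [W XW]; set k := alpha / fnorm (row i A) ^+ 2.
exists (W + k *: ((delta_mx 0 i : 'rV[R]_m)^T *m row i S)).
rewrite /= addrAC XW mulmxDr mulmxDl; congr (_ + _).
have -> : (row i A)^T = A^T *m (delta_mx 0 i)^T by rewrite rowE trmx_mul.
by rewrite -scalemxAr -scalemxAl !mulmxA.
Qed.

(** The cross term of the expanded square is - 2 alpha rho_i, since row i of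
A (X - Y) B is minus that of the residual.  The quadratic term is at most
alpha^2 |B|^2 rho_i. *)
Lemma grbk_step_fnorm i (X Y : 'M[R]_(p, q)) (S := A *m (Y - X) *m B) :
  fnorm ((grbk_step A B alpha i (X, S)).1 - Y) ^+ 2 <=
  fnorm (X - Y) ^+ 2 - c * row_ratio A S i.
Proof.
rewrite /= addrAC (fnormD_sqr (X - Y) (_ *: _)) fdotZr fnormZ_sqr fnorm_outer.
have -> : fdot (X - Y) ((row i A)^T *m (row i S *m B^T)) = - fnorm (row i S) ^+ 2.
  rewrite fdotC fdot_mulmxl trmxK fdot_mulmxr trmxK -row_mul -row_mul.
  have -> : A *m (X - Y) *m B = - S by rewrite /S -mulNmx -mulmxN opprB.
  by rewrite linearN /= -scaleN1r fdotZr mulN1r fnorm_sqr.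
have rB : fnorm (row i S *m B^T) ^+ 2 <= norm2 B ^+ 2 * fnorm (row i S) ^+ 2.
  rewrite -fnorm_tr trmx_mul trmxK -[fnorm (row i S)]fnorm_tr -exprMn.
  rewrite ler_pXn2r ?nnegrE ?fnorm_ge0 ?norm2_le //.
  exact: le_trans (fnorm_ge0 _) (norm2_le _ _).
have a0 := row_sqr_gt0 A_rows i.
rewrite /row_ratio; set a := fnorm (row i A) ^+ 2 in a0 *.
set r := fnorm (row i S) ^+ 2 in rB *.
have -> : fnorm (X - Y) ^+ 2 - c * (r / a) = fnorm (X - Y) ^+ 2 +
    2 * (alpha / a * - r) + alpha ^+ 2 / a * (norm2 B ^+ 2 * r).
  by ring.
rewrite lerD2l (_ : (alpha / a) ^+ 2 * _ = alpha ^+ 2 / a *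
  fnorm (row i S *m B^T) ^+ 2); last by field; rewrite gt_eqF.
by rewrite ler_wpM2l // divr_ge0 ?sqr_ge0 // ltW.
Qed.

Hypotheses (alpha_gt0 : 0 < alpha) (alpha_lt : alpha < 2 / norm2 B ^+ 2).

Lemma step_gain_gt0 : 0 < c.
Proof.
have b0 : 0 < norm2 B ^+ 2.
  rewrite lt_neqAle sqr_ge0 andbT eq_sym; apply/eqP => b0.
  by move: alpha_lt; rewrite b0 invr0 mulr0 ltNge ltW.
move: alpha_lt; rewrite ltr_pdivlMr // => h.
have -> : c = alpha * (2 - alpha * norm2 B ^+ 2) by ring.
by rewrite mulr_gt0 // subr_gt0.
Qed.

Lemma grbk_step_greedy i (X Y : 'M[R]_(p, q)) (S := A *m (Y - X) *m B) :
  i \in greedy_set A S ->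
  fnorm ((grbk_step A B alpha i (X, S)).1 - Y) ^+ 2 <=
  fnorm (X - Y) ^+ 2 - c * (phi A S 2^-1 * fnorm S ^+ 2).
Proof.
move=> iJ; apply: le_trans (grbk_step_fnorm i X Y) _.
rewrite lerD2l lerN2 ler_wpM2l ?(ltW step_gain_gt0) //.
exact: le_trans (gamma_ge_phi _ A_rows i) (greedy_row_ratio A_rows iJ).
Qed.

Lemma fnorm_residual_error (X Y : 'M[R]_(p, q)) :
  fnorm (A *m (Y - X) *m B) = fnorm (A *m (X - Y) *m B).
Proof. by rewrite -[Y - X]opprB mulmxN mulNmx -scaleN1r fnormZ normrN1 mul1r. Qed.

Lemma grbk_step_contraction i (X Y : 'M[R]_(p, q)) (S := A *m (Y - X) *m B) :
  normal_range A B (X - Y) -> i \in greedy_set A S ->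
  fnorm ((grbk_step A B alpha i (X, S)).1 - Y) ^+ 2 <=
  delta_theta A B alpha S 2^-1 * fnorm (X - Y) ^+ 2.
Proof.
move=> [W XW] iJ; apply: le_trans (grbk_step_greedy iJ) _.
rewrite /delta_theta (mulrBl _ 1) mul1r lerD2l lerN2.
rewrite [leLHS](_ : _ = c * (phi A S 2^-1 *
  (sigma_min A ^+ 2 * sigma_min B ^+ 2 * fnorm (X - Y) ^+ 2))); last by ring.
rewrite ler_wpM2l ?(ltW step_gain_gt0) // ler_wpM2l //.
  by apply: le_trans (phi_half_ge S A_rows i); rewrite invr_ge0 sqr_ge0.
by rewrite fnorm_residual_error XW; exact: sigma_min_sandwich.
Qed.

(** A rate that depends neither on the residual nor on the smallest singular
values, hence stays below one for matrices of deficient rank.  The maximum with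
0 makes it a valid ratio also when all the errors in question vanish, and the
added 1 in K makes K positive. *)
Lemma grbk_step_uniform_contraction (i0 : 'I_m) : exists lam, [/\ 0 <= lam, lam < 1 &
  forall i (X Y : 'M[R]_(p, q)) (S := A *m (Y - X) *m B),
  normal_range A B (X - Y) -> i \in greedy_set A S ->
  fnorm ((grbk_step A B alpha i (X, S)).1 - Y) ^+ 2 <= lam * fnorm (X - Y) ^+ 2].
Proof.
pose K := (fnorm (mp_inverse A) * fnorm (mp_inverse B)) ^+ 2 + 1.
have K0 : 0 < K by rewrite /K ltr_wpDl // sqr_ge0.
have c0 := step_gain_gt0.
exists (Num.max 0 (1 - c * ((fnorm A ^+ 2)^-1 * K^-1))); split.
- by rewrite le_max lexx.
- rewrite gt_max ltr01 /= gtrBl mulr_gt0 // mulr_gt0 ?invr_gt0 //.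
  exact: fnormA_sqr_gt0.
move=> i X Y S XY iJ; apply: le_trans (grbk_step_greedy iJ) _.
apply: (@le_trans _ _ ((1 - c * ((fnorm A ^+ 2)^-1 * K^-1)) * fnorm (X - Y) ^+ 2)).
  rewrite (mulrBl _ 1) mul1r lerD2l lerN2.
  rewrite [leLHS](_ : _ = c * ((fnorm A ^+ 2)^-1 *
    (K^-1 * fnorm (X - Y) ^+ 2))); last by ring.
  rewrite ler_wpM2l ?(ltW c0) //.
  apply: ler_pM; rewrite ?mulr_ge0 ?fnorm_ge0 ?invr_ge0 ?sqr_ge0 ?(ltW K0) //.
    exact: (phi_half_ge S A_rows i).
  rewrite mulrC ler_pdivrMr // mulrC fnorm_residual_error.
  apply: le_trans (normal_range_fnorm XY) _.
  by rewrite ler_wpM2r ?sqr_ge0 // lerDl.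
by rewrite ler_wpM2r ?sqr_ge0 // le_max lexx orbT.
Qed.

Lemma delta_theta_le (i0 : 'I_m) (S : 'M[R]_(m, n)) :
  delta_theta A B alpha S 2^-1 <= delta A B alpha.
Proof.
rewrite /delta_theta /delta lerD2l lerN2 ler_wpM2r ?sqr_ge0 // ler_wpM2r ?sqr_ge0 //.
by rewrite ler_wpM2l ?(ltW step_gain_gt0) // (phi_half_ge S A_rows i0).
Qed.

End Step.

(** * Error along a greedy path *)

Section Paths.
Context {R : realType} {m p q n : nat}.
Variables (A : 'M[R]_(m, p)) (B : 'M[R]_(q, n)) (C : 'M[R]_(m, n)).
Variables (alpha : R) (X0 : 'M[R]_(p, q)).

Local Notation iter s k := (grbk A B C alpha X0 s k).

Lemma grbk_prefix k (s s' : nat -> 'I_m) :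
  (forall j, (j < k)%N -> s j = s' j) -> iter s k = iter s' k.
Proof.
elim: k => //= k IH ss'; rewrite ss' // IH // => j jk.
by rewrite ss' // ltnW.
Qed.

Lemma grbk_residual s k Y : solution A B C Y ->
  (iter s k).2 = A *m (Y - (iter s k).1) *m B.
Proof.
move=> solY; elim: k => [|k IH] /=; first by rewrite mulmxBr mulmxBl solY.
rewrite opprD addrA mulmxBr mulmxBl -IH; congr (_ - _).
by rewrite -scalemxAr -scalemxAl !mulmxA.
Qed.

Lemma grbk_error_range s k : (exists X, solution A B C X) ->
  normal_range A B ((iter s k).1 - grbk_limit A B C X0).
Proof.
move=> cons; elim: k => [|k IH] /=; first exact: normal_range_init.
have -> : (iter s k) = ((iter s k).1, (iter s k).2) by case: (iter s k).
exact: grbk_step_normal_range.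
Qed.

Definition greedy_path (s : nat -> 'I_m) :=
  forall k, s k \in greedy_set A (iter s k).2.

Hypothesis A_rows : forall i, row i A != 0.
Hypothesis consistent : exists X, solution A B C X.
Hypotheses (alpha_gt0 : 0 < alpha) (alpha_lt : alpha < 2 / norm2 B ^+ 2).

Local Notation Y := (grbk_limit A B C X0).
Local Notation err s k := (fnorm ((iter s k).1 - Y) ^+ 2).

Lemma grbk_error_step s k : greedy_path s ->
  err s k.+1 <= delta_theta A B alpha (iter s k).2 2^-1 * err s k.
Proof.
move=> /(_ k) greedy.
have res := grbk_residual s k (solution_grbk_limit consistent X0).
have -> : iter s k.+1 = grbk_step A B alpha (s k) ((iter s k).1, (iter s k).2).
  by rewrite /=; case: (iter s k).
rewrite res in greedy *; apply: grbk_step_contraction => //.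
exact: grbk_error_range.
Qed.

Lemma grbk_error_geometric (i0 : 'I_m) : exists lam, [/\ 0 <= lam, lam < 1 &
  forall s k, greedy_path s -> err s k <= lam ^+ k * fnorm (X0 - Y) ^+ 2].
Proof.
have [lam [l0 l1 contr]] :=
  grbk_step_uniform_contraction A_rows alpha_gt0 alpha_lt i0.
exists lam; split=> // s k greedy; elim: k => [|k IH]; first by rewrite mul1r.
rewrite (exprS lam) -(mulrA lam); apply: le_trans (ler_wpM2l l0 IH).
have res := grbk_residual s k (solution_grbk_limit consistent X0).
have -> : iter s k.+1 = grbk_step A B alpha (s k) ((iter s k).1, (iter s k).2).
  by rewrite /=; case: (iter s k).
have := greedy k; rewrite res => greedyk; apply: contr => //.
exact: grbk_error_range.
Qed.

(** The factor multiplies a positive number to something above a square: the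
error cannot be zero, since the residual would vanish with it and all the
ratios would agree. *)
Lemma delta_theta_ge0 s k : greedy_path s ->
  (exists i j, row_ratio A (iter s k).2 i != row_ratio A (iter s k).2 j) ->
  0 <= delta_theta A B alpha (iter s k).2 2^-1.
Proof.
move=> greedy [i [j neq]].
have err_gt0 : 0 < err s k.
  rewrite exprn_gt0 // fnorm_gt0; apply: contraNN neq => /eqP err0.
  apply/eqP/residual0_ratios_eq.
  rewrite (grbk_residual s k (solution_grbk_limit consistent X0)).
  by rewrite -opprB err0 oppr0 mulmx0 mul0mx.
rewrite -(pmulr_lge0 _ err_gt0).
exact: le_trans (sqr_ge0 _) (grbk_error_step k greedy).
Qed.

Lemma grbk_error_prod s k : greedy_path s ->
  (forall l, exists i j, row_ratio A (iter s l).2 i != row_ratio A (iter s l).2 j) ->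
  err s k <= \prod_(l < k) delta_theta A B alpha (iter s l).2 2^-1 *
             fnorm (X0 - Y) ^+ 2.
Proof.
move=> greedy neq; elim: k => [|k IH]; first by rewrite big_ord0 mul1r.
apply: le_trans (grbk_error_step k greedy) _.
rewrite big_ord_recr /= [_ * delta_theta _ _ _ _ _]mulrC -mulrA.
by rewrite ler_wpM2l // delta_theta_ge0.
Qed.

End Paths.

(** * Events and functions of finitely many indices *)

Section RandomPaths.
Context d (T : measurableType d) (R : realType) (P : probability T R).
Context {m : nat} (I : nat -> T -> 'I_m).
Hypothesis mI : forall k i, measurable (I k @^-1` [set i]).

Lemma measurable_history s k : measurable (history I s k).
Proof.
elim: k => [|k IH].
  by rewrite (_ : history _ _ _ = setT) //; apply/seteqP; split.
rewrite (_ : history _ _ _ = history I s k `&` I k @^-1` [set s k]).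
  exact: measurableI.
apply/seteqP; split=> w /= h; first by split=> [j jk|]; apply: h => //; exact: ltnW.
by move=> j; rewrite ltnS leq_eqVlt => /predU1P[->|]; [exact: h.2|exact: h.1].
Qed.

(** Histories of length k range over a finite type through these paths.  The
length k.+1 makes [inord] well typed, including for k = 0. *)
Definition path_of k (t : k.+1.-tuple 'I_m) : nat -> 'I_m :=
  fun j => tnth t (inord j).

Lemma path_of_prefix k (s : nat -> 'I_m) j : (j < k.+1)%N ->
  path_of [tuple s i | i < k.+1] j = s j.
Proof. by move=> jk; rewrite /path_of tnth_mktuple inordK. Qed.

Lemma measurable_fun_prefix k (g : (nat -> 'I_m) -> R) :
  (forall s s', (forall j, (j < k)%N -> s j = s' j) -> g s = g s') ->
  measurable_fun setT (fun w => g (fun j => I j w)).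
Proof.
move=> gP _ U mU; rewrite setTI.
rewrite (_ : _ @^-1` U =
  \bigcup_(t in [set t : k.+1.-tuple 'I_m | U (g (path_of t))])
     history I (path_of t) k).
  apply: fin_bigcup_measurable => [|t _]; first exact: finite_finset.
  exact: measurable_history.
apply/seteqP; split=> w /= => [Uw|[t Ut hw]].
  exists [tuple I i w | i < k.+1] => /= [|j jk].
    rewrite (gP _ (fun j => I j w)) // => j jk.
    exact: (@path_of_prefix k (fun i => I i w) j (ltnW jk)).
  by rewrite (@path_of_prefix k (fun i => I i w)) // ltnW.
by rewrite (gP _ (path_of t)).
Qed.

(** A union of null events over the finitely many histories is null. *)
Lemma ae_not_history (Q : (nat -> 'I_m) -> Prop) k :
  (forall s s', (forall j, (j < k)%N -> s j = s' j) -> Q s -> Q s') ->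
  (forall s, Q s -> P (history I s k) = 0%E) ->
  {ae P, forall w, ~ Q (fun j => I j w)}.
Proof.
move=> Qprefix Q0.
have aeQ (t : k.+1.-tuple 'I_m) :
    {ae P, forall w, history I (path_of t) k w -> ~ Q (path_of t)}.
  have [Qt|nQt] := pselect (Q (path_of t)); last by apply: aeW.
  exists (history I (path_of t) k); split; [exact: measurable_history|exact: Q0|].
  by move=> w /= /not_implyP[].
apply: filterS (filter_forall _ aeQ) => w /(_ [tuple I i w | i < k.+1]) h Qw.
have pathE j : (j < k)%N -> path_of [tuple I i w | i < k.+1] j = I j w.
  by move=> jk; exact: (@path_of_prefix k (fun i => I i w) j (ltnW jk)).
by apply: h; [move=> j jk|apply: Qprefix Qw => j jk]; rewrite pathE.
Qed.

End RandomPaths.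

(** * Expectations of almost surely nonnegative variables *)

Section AlmostSureOrder.
Context d (T : measurableType d) (R : realType) (P : probability T R).

(** Passing to absolute values turns almost sure nonnegativity into nonnegativity
everywhere, under which integrals can be compared. *)
Lemma ae_expectation_normr (f : T -> R) :
  measurable_fun setT f -> {ae P, forall w, 0 <= f w} ->
  ('E_P[f] = 'E_P[(fun w => `|f w|)%R])%E.
Proof.
move=> mf f0; rewrite unlock; apply: ae_eq_integral => //.
- exact/measurable_EFinP.
- by apply/measurable_EFinP; exact: measurableT_comp.
- by apply: filterS f0 => w fw _; rewrite /= ger0_norm.
Qed.

Lemma ae_expectation_le (f g : T -> R) :
  measurable_fun setT f -> measurable_fun setT g ->
  {ae P, forall w, 0 <= f w} -> {ae P, forall w, f w <= g w} ->
  ('E_P[f] <= 'E_P[g])%E.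
Proof.
move=> mf mg f0 fg.
have g0 : {ae P, forall w, 0 <= g w}.
  by apply: filterS2 f0 fg => w; exact: le_trans.
rewrite (ae_expectation_normr mf f0) (ae_expectation_normr mg g0).
apply: expectation_le => //; try exact: measurableT_comp.
by apply: filterS3 f0 g0 fg => w /= f0 g0 fg; rewrite !ger0_norm.
Qed.

Lemma ae_expectationZr (f : T -> R) (c : R) :
  measurable_fun setT f -> {ae P, forall w, 0 <= f w} -> 0 <= c ->
  ('E_P[f] * c%:E = 'E_P[fun w => (f w * c)%R])%E.
Proof.
move=> mf f0 c0; rewrite (ae_expectation_normr mf f0).
rewrite (@ae_expectation_normr (fun w => f w * c)); first last.
- by apply: filterS f0 => w fw; rewrite mulr_ge0.
- exact: measurable_funM.
rewrite unlock -ge0_integralZr //.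
- by apply: eq_integral => w _; rewrite normrM (ger0_norm c0) EFinM.
- by apply/measurable_EFinP; exact: measurableT_comp.
Qed.

End AlmostSureOrder.

(** * Convergence of the greedy randomized block Kaczmarz method *)

Theorem theorem4p2 (R : realType) (d : measure_display)
    (T : measurableType d) (P : probability T R) (m p q n : nat)
    (A : 'M[R]_(m, p)) (B : 'M[R]_(q, n)) (C : 'M[R]_(m, n))
    (alpha : R) (X0 : 'M[R]_(p, q)) (I : nat -> T -> 'I_m)
    (A_rows : forall i : 'I_m, row i A != 0)
    (consistent : exists X : 'M[R]_(p, q), solution A B C X)
    (alpha_gt0 : 0 < alpha)
    (alpha_lt : alpha < 2 / norm2 B ^+ 2)
    (I_law : grbk_indices P A B C alpha X0 I) :
  let Xk (k : nat) (w : T) : 'M[R]_(p, q) :=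
    (grbk A B C alpha X0 (fun j => I j w) k).1 in
  let Rk (k : nat) (w : T) : 'M[R]_(m, n) :=
    (grbk A B C alpha X0 (fun j => I j w) k).2 in
  let dk (k : nat) (w : T) : R := delta_theta A B alpha (Rk k w) 2^-1 in
  let Xs : 'M[R]_(p, q) := mp_inverse A *m C *m mp_inverse B in
  {ae P, forall w, forall k : nat,
     exists i j : 'I_m, row_ratio A (Rk k w) i != row_ratio A (Rk k w) j} ->
  (exists Y : 'M[R]_(p, q), solution A B C Y /\ cvg_in_expectation P Xk Y) /\
  (range_sub X0 A^T -> range_sub X0^T B ->
   [/\ (forall Y : 'M[R]_(p, q), min_norm_solution A B C Y <-> Y = Xs),
       cvg_in_expectation P Xk Xs,
       (forall k : nat, {ae P, forall w,
          (cond_expect P I k (fun w' => fnorm (Xk k.+1 w' - Xs) ^+ 2)%R w <=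
             (dk k w * fnorm (Xk k w - Xs) ^+ 2)%R%:E)%E /\
          dk k w * fnorm (Xk k w - Xs) ^+ 2 <=
             delta A B alpha * fnorm (Xk k w - Xs) ^+ 2}) &
       (forall k : nat,
          ('E_P[(fun w => fnorm (Xk k.+1 w - Xs) ^+ 2)%R] <=
             'E_P[(fun w => \prod_(l < k.+1) dk l w)%R] *
             (fnorm (X0 - Xs) ^+ 2)%R%:E)%E /\
          ('E_P[(fun w => \prod_(l < k.+1) dk l w)%R] *
             (fnorm (X0 - Xs) ^+ 2)%R%:E <=
             (delta A B alpha ^+ k.+1 * fnorm (X0 - Xs) ^+ 2)%R%:E)%E)]).
Proof.
move=> Xk Rk dk Xs ratios_neq.
pose Y := grbk_limit A B C X0.
have solY : solution A B C Y := solution_grbk_limit consistent X0.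
have [mI Ilaw] := I_law.
pose g w := fun j => I j w.
(* The law of the index gives probability zero to a history ending with a row
   outside the greedy set. *)
have greedy_ae : {ae P, forall w, greedy_path A B C alpha X0 (g w)}.
  apply: ae_foralln => k.
  pose Q s := s k \notin greedy_set A (grbk A B C alpha X0 s k).2.
  have : {ae P, forall w, ~ Q (g w)}.
    apply: (@ae_not_history _ _ _ P _ _ mI Q k.+1) => [s s' ss'|s Qs].
      rewrite /Q ss' // (@grbk_prefix _ _ _ _ _ A B C alpha X0 k s s') // => j jk.
      by rewrite ss' // ltnW.
    by rewrite Ilaw select_prob_greedy // mule0.
  by apply: filterS => w; rewrite /Q => /negP; rewrite negbK.
pose err k w := fnorm (Xk k w - Y) ^+ 2.
have m_err k : measurable_fun setT (err k).
  apply: (@measurable_fun_prefix _ _ _ _ _ mI k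
    (fun s => fnorm ((grbk A B C alpha X0 s k).1 - Y) ^+ 2)) => s s' ss'.
  by rewrite (grbk_prefix A B C alpha X0 ss').
have err_ge0 k w : 0 <= err k w by exact: sqr_ge0.
(* The total mass 1 forces an outcome, hence a row index. *)
have [w0 _] : [set: T] !=set0.
  apply/set0P/eqP => T0; have := probability_setT P.
  by rewrite T0 measure0 => /eqP; rewrite eq_sym onee_eq0.
have i0 : 'I_m := I 0 w0.
have cvgY : cvg_in_expectation P Xk Y.
  have [lam [lam0 lam1 contr]] :=
    grbk_error_geometric X0 A_rows consistent alpha_gt0 alpha_lt i0.
  pose u k := (lam ^+ k * fnorm (X0 - Y) ^+ 2)%:E.
  apply: (@squeeze_cvge _ _ _ _ (cst 0%E) _ u); last 2 first.
  - exact: cvg_cst.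
  - apply: cvg_EFin; first by apply: nearW.
    rewrite -[X in _ --> X](mul0r (fnorm (X0 - Y) ^+ 2)).
    apply: cvgM; last exact: cvg_cst.
    by apply: cvg_expr; rewrite ger0_norm.
  apply: nearW => k; apply/andP; split.
    by apply: expectation_ge0 => w; exact: err_ge0.
  rewrite /u -(expectation_cst P); apply: ae_expectation_le => //.
  - exact: m_err.
  - by apply: aeW => w; exact: err_ge0.
  - by apply: filterS greedy_ae => w; exact: contr.
split; first by exists Y.
move=> range_l range_r.
have YXs : Y = Xs by exact/grbk_limit_normal_range/range_sub_normal_range.
have step_ae : {ae P, forall w, forall k, err k.+1 w <= dk k w * err k w}.
  by apply: filterS greedy_ae => w gw k; exact: grbk_error_step.
have dk_ge0 : {ae P, forall w, forall k, 0 <= dk k w}.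
  apply: filterS2 greedy_ae ratios_neq => w gw neq k.
  exact: (delta_theta_ge0 A_rows consistent alpha_gt0 alpha_lt gw (neq k)).
have dk_le k w : dk k w <= delta A B alpha by exact: delta_theta_le.
(* On the event that the first k indices are those seen at w, the iterate and
   the factor at time k are constants. *)
have Xk_prefix k w w' : history I (g w) k w' -> Xk k w' = Xk k w /\ dk k w' = dk k w.
  move=> h; rewrite /Xk /dk /Rk.
  by rewrite (@grbk_prefix _ _ _ _ _ A B C alpha X0 k (g w') (g w)).
rewrite -/Xs -YXs; split.
- by move=> Z; rewrite YXs; exact: min_norm_solution_mp.
- exact: cvgY.
- move=> k; apply: filterS (step_ae) => w stepw; split; last first.
    by rewrite ler_wpM2r // sqr_ge0.
  rewrite /cond_expect -/(g w); set F := history _ _ _.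
  have mF : measurable F by exact: measurable_history.
  set b := dk k w * _.
  have b0 : 0 <= b := le_trans (err_ge0 k.+1 w) (stepw k).
  have PF : P F = (fine (P F))%:E by rewrite fineK // fin_num_measure.
  have int_le : (\int[P]_(x in F) (err k.+1 x)%:E <= b%:E * P F)%E.
    rewrite -integral_cst //; apply: ae_ge0_le_integral => //.
    - by move=> x _; rewrite lee_fin; exact: err_ge0.
    - by apply/measurable_EFinP; exact: measurable_funTS.
    - apply: filterS step_ae => w' stepw' Fw'; rewrite lee_fin.
      apply: le_trans (stepw' k) _; have [] := Xk_prefix k w w' Fw'.
      by rewrite /err => -> ->.
  have F0 : 0 <= (fine (P F))^-1 by rewrite invr_ge0 fine_ge0.
  apply: le_trans (lee_wpmul2l _ int_le) _; first by rewrite lee_fin.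
  rewrite PF -!EFinM lee_fin /=.
  (* On a null event the average is 0, by the convention on 0^-1. *)
  have [->|PF0] := eqVneq (fine (P F)) 0; first by rewrite mulr0 mulr0.
  by rewrite mulrCA mulVf // mulr1.
move=> k; pose prod w := \prod_(l < k.+1) dk l w.
have m_prod : measurable_fun setT prod.
  apply: (@measurable_fun_prefix _ _ _ _ _ mI k (fun s => \prod_(l < k.+1)
    delta_theta A B alpha (grbk A B C alpha X0 s l).2 2^-1)) => s s' ss'.
  apply: eq_bigr => l _; rewrite (@grbk_prefix _ _ _ _ _ A B C alpha X0 l s s') //.
  by move=> j jl; apply: ss'; apply: leq_trans jl _; rewrite -ltnS.
have prod_ge0 : {ae P, forall w, 0 <= prod w}.
  by apply: filterS dk_ge0 => w dw; apply: prodr_ge0 => l _.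
have m_prodM : measurable_fun setT (fun w => prod w * fnorm (X0 - Y) ^+ 2).
  exact: measurable_funM.
rewrite (ae_expectationZr m_prod prod_ge0) ?sqr_ge0 //; split.
  apply: ae_expectation_le => //; first exact: m_err.
    by apply: aeW => w; exact: err_ge0.
  apply: filterS2 greedy_ae ratios_neq => w gw neq.
  exact: (grbk_error_prod A_rows consistent alpha_gt0 alpha_lt k.+1 gw neq).
rewrite -(expectation_cst P); apply: ae_expectation_le => //.
  by apply: filterS prod_ge0 => w prodw; rewrite mulr_ge0 ?sqr_ge0.
apply: filterS dk_ge0 => w dw; rewrite ler_wpM2r ?sqr_ge0 //.
rewrite -[k.+1 in leRHS]card_ord -prodr_const.
by apply: ler_prod => l _; rewrite dw dk_le.
Qed.
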